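(* There exists an absolute constant $C>0$ such that the following holds. Let $m>n\ge 2$ be integers, $A\in\mathbb{R}^{m\times n}$ a matrix all of whose rows have Euclidean norm $1$, $b\in\mathbb{R}^m$, and let $P=\{x\in\mathbb{R}^n : Ax\le b\}$ be a nonempty non-degenerate polytope. Let $\Delta$ be the largest absolute value of the $(n-1)\times(n-1)$ sub-determinants of $A$, and let $\det(A^* )=\min_{v\in V}|\det(A_v)|$, where $V$ is the set of vertices of $P$ and $A_v$ is the $n\times n$ submatrix of $A$ formed by the rows tight at $v$. Then the diameter $\operatorname{diam}(P)$ satisfies: (i) if $\det(A^* )\ge \tfrac12$, then $\operatorname{diam}(P)\le C\, n^3\ln(n)\,\Delta$; (ii) if $\det(A^* )<\tfrac12$, then $\operatorname{diam}(P)\le C\,\dfrac{n^3\Delta}{\det(A^* )}\,\ln\!\left(\dfrac{n}{\det(A^* )}\right)$.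
   Context: A polytope is a bounded set of the form $P=\{x\in\mathbb{R}^n: Ax\le b\}$. A vertex of $P$ is a point $v\in P$ at which equality holds in $n$ of the inequalities whose rows of $A$ are linearly independent. $P$ is non-degenerate if at each vertex exactly $n$ of the $m$ inequalities of $Ax\le b$ are tight (hold with equality); then, for a vertex $v$, $A_v$ denotes the (invertible) $n\times n$ submatrix of $A$ consisting of the rows tight at $v$. Two distinct vertices are neighbours (adjacent) if they are joined by an edge of $P$, i.e. there are $n-1$ linearly independent rows of $A$ whose inequalities are tight at both. The diameter $\operatorname{diam}(P)$ is the smallest integer $d$ such that any two vertices of $P$ are connected by a path consisting of at most $d$ edges of $P$. *)

(* Defs.v *)
From HB Require Import structures.
From mathcomp Require Import all_boot all_order all_algebra.
From mathcomp Require Import all_classical all_reals all_analysis.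

Set Implicit Arguments.
Unset Strict Implicit.
Unset Printing Implicit Defensive.

Import Order.TTheory GRing.Theory Num.Theory.
Import numFieldNormedType.Exports.

Local Open Scope classical_set_scope.
Local Open Scope ring_scope.

Definition least d (T : porderType d) (S : set T) (x : T) : Prop :=
  S x /\ lbound S x.

Section Polytopes.
Variables (R : realType) (m n : nat).
Implicit Types (A : 'M[R]_(m, n)) (b : 'cV[R]_m) (v w x : 'cV[R]_n).

Definition unit_rows A : Prop :=
  forall i, Num.sqrt (\sum_(j < n) A i j ^+ 2) = 1.

Definition polyhedron A b : set 'cV[R]_n :=
  [set x | forall i, (A *m x) i 0 <= b i 0].

Definition tight A b x : {set 'I_m} := [set i | (A *m x) i 0 == b i 0]%SET.

(* [row_free (rowsub f A)] forces [f] to be injective. *)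
Definition tight_independent (k : nat) A b (S : set 'cV[R]_n) : Prop :=
  exists f : 'I_k -> 'I_m,
    row_free (rowsub f A) /\ forall v, S v -> forall i, f i \in tight A b v.

Definition vertex A b : set 'cV[R]_n :=
  [set v | polyhedron A b v /\ tight_independent n A b [set v]].

Definition non_degenerate A b : Prop :=
  forall v, vertex A b v -> #|tight A b v| = n.

(* The submatrix of [A] with rows [I] and columns [J], in increasing order.
   Its type is only propositionally square: [conform_mx] casts it to ['M_k],
   and the default value [0] is returned if [I] or [J] does not have exactly
   [k] elements. *)
Definition square_submx (k : nat) A (I : {set 'I_m}) (J : {set 'I_n}) : 'M[R]_k :=
  conform_mx 0 (mxsub (fun i : 'I_#|I| => enum_val i)
                      (fun j : 'I_#|J| => enum_val j) A).

Definition max_subdet (k : nat) A : R :=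
  \big[Num.max/0]_(I : {set 'I_m} | #|I| == k)
    \big[Num.max/0]_(J : {set 'I_n} | #|J| == k) `|\det (square_submx k A I J)|.

Definition tight_mx A b v : 'M[R]_n :=
  square_submx n A (tight A b v) [set: 'I_n]%SET.

Definition is_min_vertex_det A b (d : R) : Prop :=
  least [set `|\det (tight_mx A b v)| | v in vertex A b] d.

Definition adjacent A b v w : Prop :=
  [/\ vertex A b v, vertex A b w, v <> w
    & tight_independent n.-1 A b [set v; w]].

Definition joined_within A b (k : nat) : Prop :=
  forall v w, vertex A b v -> vertex A b w ->
    exists p : seq 'cV[R]_n,
      [/\ path (fun x y => `[< adjacent A b x y >]) v p,
          last v p = w & (size p <= k)%N].

Definition is_diameter A b (d : nat) : Prop := least (joined_within A b) d.

End Polytopes.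

(* Main.v *)
(* Let [Z] be a natural number of order [n^2 Delta / d], [d] being the smallest
   vertex determinant. By Cramer's rule every vertex cone [N(v)] (the objectives
   maximised at [v]) has in its interior a whole cube [z + [-1,1]^n], with [z] an
   integer vector of sup-norm at most [Z]. A point of the lattice whose
   surrounding unit cube meets [N(v)] is therefore carried into the interior of
   [N(v)] by the translation by [z]; these interiors are disjoint, so among the
   lattice points of a cube of side [L = 4nZ], a unit cube meets at most
   [((L + 2Z) / L)^n <= 2] vertex cones on average.

   A simplex walk follows the segment from one objective to another inside a
   convex set, visiting no more vertices than there are cones meeting this set.
   Move the random objective [c + l X], with [X] in the lattice cube, by steps of
   sup-norm at most [l]: first inflate [l] from 1 to [Z] about the centre of the
   starting cone ([L log Z] steps), then translate to the target cone
   ([O(L)] steps), then deflate back. A walk of at most average length has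
   [O(n Z log Z)] edges, and Hadamard's inequality gives [Delta <= 1], which
   removes [Delta] from the logarithm. *)
Require Import Defs.
From HB Require Import structures.
From mathcomp Require Import all_boot all_order all_algebra.
From mathcomp Require Import perm.
From mathcomp Require Import all_classical all_reals all_analysis.
From mathcomp Require Import ring lra zify.
Import Order.TTheory GRing.Theory Num.Theory.
Import numFieldNormedType.Exports.
Local Open Scope classical_set_scope.
Local Open Scope ring_scope.

Set Implicit Arguments.
Unset Strict Implicit.
Unset Printing Implicit Defensive.

(** * Hadamard's inequality and bounds on minors *)

Section Determinants.
Variable R : realType.

Lemma row_gramE p q (M : 'M[R]_(p, q)) i :
  (M *m M^T) i i = \sum_j M i j ^+ 2.
Proof. by rewrite mxE; apply: eq_bigr => j _; rewrite mxE expr2. Qed.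

(** With [r] the norm of [a], the reflection in the hyperplane orthogonal to [w = a - r e_0] sends
    [a] to [r e_0]. Half of [|w|^2] equals [s - r a_0]; if it vanishes, [a] already lies on the axis
    and the identity serves. *)
Lemma householder k (a : 'rV[R]_k.+1) :
  exists Q : 'M[R]_k.+1, Q *m Q^T = 1%:M /\
    forall j, j != 0 -> (a *m Q) 0 j = 0.
Proof.
pose s := (a *m a^T) 0 0; pose r := Num.sqrt s.
have s_ge0 : 0 <= s by rewrite /s row_gramE; apply: sumr_ge0 => j _; apply: sqr_ge0.
have r2 : r ^+ 2 = s by rewrite sqr_sqrtr.
pose w : 'rV[R]_k.+1 := a - r *: delta_mx 0 0.
have aw : a *m w^T = (s - r * a 0 0)%:M.
  apply/matrixP => i j; rewrite !ord1 /w linearB /= linearZ /= trmx_delta.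
  rewrite mulmxBr -scalemxAr -colE.
  by rewrite [LHS]mxE -/s !mxE /= mulr1n.
have ww : w *m w^T = (2 * (s - r * a 0 0))%:M.
  rewrite {1}/w mulmxBl aw -scalemxAl -rowE.
  apply/matrixP => i j; rewrite !ord1 !mxE /= !mulr1n -r2; ring.
have [w0|w0] := eqVneq (s - r * a 0 0) 0.
  have {}w0 : w = 0.
    move: ww; rewrite w0 mulr0 => /(congr1 (fun M : 'M[R]_1 => M 0 0)).
    rewrite row_gramE mxE /= mul0rn => /eqP.
    rewrite psumr_eq0 => [/allP wj0|i _]; last exact: sqr_ge0.
    apply/matrixP => i j; rewrite ord1 [RHS]mxE; apply/eqP.
    by rewrite -sqrf_eq0; apply: wj0; rewrite mem_index_enum.
  exists 1%:M; rewrite trmx1 mulmx1; split=> // j j0.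
  move/eqP: w0; rewrite mulmx1 subr_eq0 => /eqP ->.
  by rewrite !mxE (negPf j0) mulr0.
set e := s - r * a 0 0 in aw ww w0.
exists (1%:M - e^-1 *: (w^T *m w)); split.
  have -> : (1%:M - e^-1 *: (w^T *m w))^T = 1%:M - e^-1 *: (w^T *m w).
    by rewrite linearB /= trmx1 linearZ /= trmx_mul trmxK.
  have PP : w^T *m w *m (w^T *m w) = (2 * e) *: (w^T *m w).
    by rewrite -mulmxA [w *m _]mulmxA ww mul_scalar_mx -scalemxAr.
  rewrite mulmxBr mulmx1 mulmxBl mul1mx -!scalemxAr -!scalemxAl PP !scalerA.
  apply/matrixP => i j; rewrite !mxE; set W := \sum_(_ < _) _.
  by field.
move=> j j0; rewrite mulmxBr mulmx1 -scalemxAr mulmxA aw mul_scalar_mx scalerA.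
by rewrite mulVf // scale1r /w opprB addrCA subrr addr0 !mxE (negPf j0) mulr0.
Qed.

(** An orthogonal matrix turns the first row into a multiple of the first axis vector. Expanding
    along it leaves a single minor, whose rows are truncations of rows of norm at most 1, so
    induction applies. *)
Lemma hadamard k (M : 'M[R]_k) :
  (forall i, \sum_j M i j ^+ 2 <= 1) -> \det M ^+ 2 <= 1.
Proof.
elim: k M => [|k IH] M rowM; first by rewrite det_mx00 expr1n.
have [Q [QQ aQ]] := householder (row 0 M).
have detQ : \det Q ^+ 2 = 1 by rewrite expr2 -{2}det_tr -det_mulmx QQ det1.
pose N := M *m Q.
have rowN i : \sum_j N i j ^+ 2 <= 1.
  by rewrite -row_gramE trmx_mul mulmxA -(mulmxA M) QQ mulmx1 row_gramE.
have N0 j : j != 0 -> N 0 j = 0.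
  by move=> j0; have := aQ j j0; rewrite -row_mul mxE.
have -> : \det M ^+ 2 = \det N ^+ 2 by rewrite det_mulmx exprMn detQ mulr1.
rewrite (expand_det_row _ 0) (bigD1 0) //= big1 ?addr0 => [|j j0]; last by rewrite N0 ?mul0r.
have := rowN 0; rewrite (bigD1 0) //= big1 ?addr0 => [|j j0]; last by rewrite N0 ?expr0n.
move=> N00; rewrite exprMn -[leRHS]mulr1; apply: ler_pM => //; rewrite ?sqr_ge0 //.
rewrite /cofactor addn0 expr0 mul1r; apply: IH => i.
apply: le_trans (rowN (lift 0 i)).
rewrite [leRHS]big_ord_recl -[leLHS]add0r; apply: lerD; first exact: sqr_ge0.
by apply: ler_sum => j _; rewrite !mxE.
Qed.

(** Two enumerations of the same rows and columns differ by permutations, which only affect the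
    sign. This frees the sequel from the increasing order in [square_submx]. *)
Lemma normr_det_square_submx m n k (A : 'M[R]_(m, n))
    (I : {set 'I_m}) (J : {set 'I_n}) (f : 'I_k -> 'I_m) (h : 'I_k -> 'I_n) :
  #|I| = k -> #|J| = k -> injective f -> injective h ->
  (forall i, f i \in I) -> (forall j, h j \in J) ->
  `|\det (mxsub f h A)| = `|\det (square_submx k A I J)|.
Proof.
move=> cI cJ injf injh fI hJ.
pose u i := cast_ord cI (enum_rank_in (fI i) (f i)).
pose u' i := cast_ord cJ (enum_rank_in (hJ i) (h i)).
have uK i : enum_val (cast_ord (esym cI) (u i)) = f i.
  by rewrite cast_ordK enum_rankK_in.
have u'K i : enum_val (cast_ord (esym cJ) (u' i)) = h i.
  by rewrite cast_ordK enum_rankK_in.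
have inju : injective u by move=> i j eij; apply: injf; rewrite -!uK eij.
have inju' : injective u' by move=> i j eij; apply: injh; rewrite -!u'K eij.
have conformE p q (M : 'M[R]_(p, q)) (ep : p = k) (eq : q = k) :
    conform_mx (0 : 'M[R]_k) M = mxsub (cast_ord (esym ep)) (cast_ord (esym eq)) M.
  by subst p q; rewrite conform_mx_id; apply/matrixP => i j; rewrite mxE !cast_ord_id.
rewrite /square_submx (conformE _ _ _ cI cJ).
set N := mxsub (cast_ord _) _ _.
have -> : mxsub f h A = row_perm (perm inju) (col_perm (perm inju') N).
  by apply/matrixP => i j; rewrite !mxE !permE uK u'K.
by rewrite row_permE col_permE !det_mulmx !det_perm !normrM !normr_sign mul1r mulr1.
Qed.

Lemma max_subdet_ge m n k (A : 'M[R]_(m, n)) (f : 'I_k -> 'I_m) (h : 'I_k -> 'I_n) :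
  injective f -> injective h -> `|\det (mxsub f h A)| <= max_subdet k A.
Proof.
move=> injf injh.
pose I := [set f i | i : 'I_k]%SET; pose J := [set h i | i : 'I_k]%SET.
have cI : #|I| = k by rewrite card_imset ?card_ord.
have cJ : #|J| = k by rewrite card_imset ?card_ord.
rewrite (normr_det_square_submx A cI cJ) // => [|i|i]; [|exact: imset_f..].
apply: (bigmax_sup I); first exact/eqP.
by apply: (bigmax_sup J) => //; exact/eqP.
Qed.

Lemma unit_rows_sum m n (A : 'M[R]_(m, n)) i :
  unit_rows A -> \sum_j A i j ^+ 2 = 1.
Proof.
move=> /(_ i) A1.
have s0 : 0 <= \sum_j A i j ^+ 2 by apply: sumr_ge0 => j _; apply: sqr_ge0.
by rewrite -(sqr_sqrtr s0) A1 expr1n.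
Qed.

Lemma unit_rows_entry m n (A : 'M[R]_(m, n)) i j : unit_rows A -> `|A i j| <= 1.
Proof.
move=> A1; rewrite -(@expr_le1 _ 2) // -normrX ger0_norm ?sqr_ge0 //.
rewrite -(unit_rows_sum i A1) (bigD1 j) //= lerDl.
by apply: sumr_ge0 => l _; apply: sqr_ge0.
Qed.

Lemma max_subdet_le1 m n k (A : 'M[R]_(m, n)) : unit_rows A -> max_subdet k A <= 1.
Proof.
move=> A1; apply: bigmax_le => // I /eqP cI; apply: bigmax_le => // J /eqP cJ.
pose f (i : 'I_k) := enum_val (cast_ord (esym cI) i).
pose h (i : 'I_k) := enum_val (cast_ord (esym cJ) i).
have injf : injective f by move=> i j /enum_val_inj/cast_ord_inj.
have injh : injective h by move=> i j /enum_val_inj/cast_ord_inj.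
rewrite -(normr_det_square_submx A cI cJ injf injh) => [|i|i]; [|exact: enum_valP..].
rewrite -(@expr_le1 _ 2) // -normrX ger0_norm ?sqr_ge0 //.
apply: hadamard => i; rewrite -(unit_rows_sum (f i) A1).
under eq_bigr do rewrite mxE.
rewrite -(big_imset (fun j => A (f i) j ^+ 2) (h := h) (A := predT)) /=; last first.
  by move=> ? ? _ _ /injh.
rewrite [leRHS](bigID (mem (h @: predT))) /= lerDl.
by apply: sumr_ge0 => l _; apply: sqr_ge0.
Qed.

Lemma cofactor_rowsub_le m n (A : 'M[R]_(m, n)) (f : 'I_n -> 'I_m) i j :
  injective f -> `|cofactor (rowsub f A) i j| <= max_subdet n.-1 A.
Proof.
move=> injf; rewrite normrM normr_sign mul1r.
have -> : row' i (col' j (rowsub f A)) = mxsub (f \o lift i) (lift j) A.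
  by apply/matrixP => k l; rewrite !mxE.
by apply: max_subdet_ge; [move=> ? ? /injf /lift_inj|exact: lift_inj].
Qed.

(** Cramer's rule: an entry of the inverse is a cofactor over the determinant. *)
Lemma invmx_rowsub_le m n (A : 'M[R]_(m, n)) (f : 'I_n -> 'I_m) (d : R) i j :
  injective f -> 0 < d -> d <= `|\det (rowsub f A)| ->
  `|invmx (rowsub f A) i j| <= max_subdet n.-1 A / d.
Proof.
move=> injf d0 dM.
have D0 : 0 < `|\det (rowsub f A)| by exact: lt_le_trans dM.
rewrite /invmx unitmxE unitfE -normr_gt0 D0 mxE normrM normfV mulrC.
apply: ler_pM; rewrite ?normr_ge0 ?invr_ge0 //.
  by rewrite mxE; exact: cofactor_rowsub_le.
by rewrite lef_pV2.
Qed.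

(** Expansion along the first row, whose entries are at most 1. It later gives
    [1 <= n Delta / d]. *)
Lemma det_rowsub_le m n (A : 'M[R]_(m, n)) (f : 'I_n -> 'I_m) :
  unit_rows A -> (0 < n)%N -> injective f ->
  `|\det (rowsub f A)| <= n%:R * max_subdet n.-1 A.
Proof.
move=> A1 n0 injf; rewrite (expand_det_row _ (Ordinal n0)).
apply: le_trans (ler_norm_sum _ _ _) _.
rewrite mulr_natl -[X in _ *+ X](card_ord n) -sumr_const.
apply: ler_sum => j _; rewrite normrM -[leRHS]mul1r; apply: ler_pM => //.
  by rewrite mxE; exact: unit_rows_entry.
exact: cofactor_rowsub_le.
Qed.

End Determinants.

(** * Normal cones and simplex pivots *)

Section Geometry.
Variables (R : realType) (m n : nat) (A : 'M[R]_(m, n)) (b : 'cV[R]_m).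
Implicit Types (v w y : 'cV[R]_n) (x p q : 'rV[R]_n).

Definition normal_cone v : set 'rV[R]_n :=
  [set x | forall y, polyhedron A b y -> (x *m y) 0 0 <= (x *m v) 0 0].

(** Uniqueness of the maximiser replaces a topological interior, which makes disjointness for
    distinct vertices immediate. *)
Definition open_normal_cone v : set 'rV[R]_n :=
  [set x | forall y, polyhedron A b y -> y <> v -> (x *m y) 0 0 < (x *m v) 0 0].

Definition vertex_basis v (f : 'I_n -> 'I_m) : Prop :=
  [/\ injective f, rowsub f A \in unitmx, rowsub f A *m v = rowsub f b
    & tight A b v = [set f i | i : 'I_n]%SET].

Lemma mul_rowsub k (f : 'I_k -> 'I_m) v i : (rowsub f A *m v) i 0 = (A *m v) (f i) 0.
Proof. by rewrite !mxE; apply: eq_bigr => j _; rewrite mxE. Qed.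

Lemma in_tight v i : (i \in tight A b v) = ((A *m v) i 0 == b i 0).
Proof. by rewrite /tight inE. Qed.

Lemma row_free_inj k (f : 'I_k -> 'I_m) : row_free (rowsub f A) -> injective f.
Proof.
move=> /row_freeP[B fB] i j eij.
have : row i (1%:M : 'M[R]_k) = row j 1%:M.
  by rewrite -fB !row_mul; congr (_ *m _); apply/matrixP => ? l; rewrite !mxE eij.
move/matrixP => /(_ 0 i); rewrite !mxE eqxx; case: (eqVneq j i) => // _ /eqP.
by rewrite oner_eq0.
Qed.

Lemma vertexP v :
  non_degenerate A b -> vertex A b v -> exists f, vertex_basis v f.
Proof.
move=> nd Vv; have [Pv [f [frf tf]]] := Vv.
have Mu : rowsub f A \in unitmx by rewrite -row_free_unit.
have injf := row_free_inj frf.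
have ftight i : f i \in tight A b v by exact: tf.
exists f; split; [exact: injf|exact: Mu| |].
  apply/matrixP => i j; rewrite ord1 mul_rowsub [RHS]mxE.
  by have := ftight i; rewrite in_tight => /eqP.
apply/esym/eqP; rewrite eqEcard (nd v Vv) card_imset // card_ord leqnn andbT.
by apply/fintype.subsetP => _ /imsetP[i _ ->].
Qed.

Lemma vertex_tight_inj v w : non_degenerate A b -> vertex A b v -> vertex A b w ->
  tight A b v = tight A b w -> v = w.
Proof.
move=> nd Vv Vw vw; have [f [_ fu fw wf]] := vertexP nd Vw.
apply: (can_inj (mulKmx fu)); rewrite fw; apply/matrixP => i j.
rewrite ord1 mul_rowsub [RHS]mxE; apply/eqP; rewrite -in_tight vw wf.
exact: imset_f.
Qed.

Lemma det_tight_mx v f : vertex_basis v f ->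
  `|\det (tight_mx A b v)| = `|\det (rowsub f A)|.
Proof.
move=> [injf _ _ tE].
rewrite /tight_mx -(@normr_det_square_submx _ m n n A _ _ f id) //.
- by rewrite tE card_imset // card_ord.
- by rewrite cardsT card_ord.
- by move=> ?; rewrite tE imset_f.
- by move=> ?; rewrite finset.in_setT.
Qed.

Section Basis.
Variables (v : 'cV[R]_n) (f : 'I_n -> 'I_m).
Hypothesis vf : vertex_basis v f.
Let G := invmx (rowsub f A).

(** The entries of [x *m G] are the coordinates of [x] in the basis of tight rows, i.e. the dual
    multipliers. As [v] has no slack on these rows, the gap is the sum of multipliers times slacks
    of [y]. *)
Lemma dual_gap x y : (x *m v) 0 0 - (x *m y) 0 0 =
  \sum_i (x *m G) 0 i * (b (f i) 0 - (A *m y) (f i) 0).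
Proof.
have [_ Mu Mv _] := vf.
have -> : (x *m v) 0 0 - (x *m y) 0 0 = (x *m G *m (rowsub f A *m (v - y))) 0 0.
  by rewrite !mulmxA mulmxKV // mulmxBr !mxE.
rewrite mulmxBr Mv mxE; apply: eq_bigr => i _; congr (_ * _).
by rewrite mxE [X in _ + X]mxE mul_rowsub mxE.
Qed.

Lemma normal_cone_basis x : (forall i, 0 <= (x *m G) 0 i) -> normal_cone v x.
Proof.
move=> x0 y Py; rewrite -subr_ge0 dual_gap; apply: sumr_ge0 => i _.
by apply: mulr_ge0; [exact: x0|rewrite subr_ge0; exact: Py].
Qed.

Lemma open_normal_cone_basis x :
  (forall i, 0 < (x *m G) 0 i) -> open_normal_cone v x.
Proof.
move=> x0 y Py yv; rewrite -subr_gt0 lt_neqAle; apply/andP; split; last first.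
  by rewrite subr_ge0; apply: normal_cone_basis => // i; exact: ltW.
apply/eqP => /esym/eqP; rewrite dual_gap psumr_eq0; last first.
  by move=> i _; apply: mulr_ge0; [exact: ltW|rewrite subr_ge0; exact: Py].
move=> /allP z; apply: yv; have [_ Mu Mv _] := vf.
apply: (can_inj (mulKmx Mu)); rewrite Mv; apply/matrixP => i j.
rewrite ord1 mul_rowsub [RHS]mxE; apply/esym/eqP; rewrite -subr_eq0.
have := z i (mem_index_enum _); rewrite mulf_eq0 => /orP[/eqP xi0|//].
by have := x0 i; rewrite xi0 ltxx.
Qed.

Lemma col_basisE i j : (A *m col i G) (f j) 0 = (j == i)%:R.
Proof.
have [_ Mu _ _] := vf.
by rewrite -mul_rowsub colE mulmxA mulmxV // mul1mx mxE eqxx andbT.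
Qed.

(** Moving along [- col i G] relaxes the row [f i] and keeps the other tight rows tight; a ratio
    test finds the first blocking row. *)
Lemma pivot i : polyhedron A b v -> bounded_set (polyhedron A b) ->
  exists2 s, 0 < s & Defs.adjacent A b v (v - s *: col i G).
Proof.
move=> Pv bndP; have [injf Mu Mv tightE] := vf.
set g := col i G.
have Ag s k : (A *m (v - s *: g)) k 0 = (A *m v) k 0 - s * (A *m g) k 0.
  by rewrite mulmxBr -scalemxAr !mxE.
have g0 : g != 0.
  apply/eqP => g0; have := col_basisE i i; rewrite -/g g0 mulmx0 mxE eqxx => /eqP.
  by rewrite eq_sym oner_eq0.
(* Without a blocking row the whole ray from [v] would lie in the polytope, against boundedness. *)
have [k0 k0P] : exists k, (A *m g) k 0 < 0.
  apply/existsP; apply: contraT; rewrite negb_exists => /forallP Ag0.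
  have ray s : 0 <= s -> polyhedron A b (v - s *: g).
    move=> s0 k; rewrite Ag; apply: le_trans (Pv k).
    by rewrite gerBl mulr_ge0 // leNgt.
  have [M [_ MP]] := bndP.
  have {}MP : forall y, polyhedron A b y -> `|y| <= `|M| + 1.
    by move=> y; apply: MP; rewrite (le_lt_trans (ler_norm M)) // ltrDl.
  have ng : 0 < `|g| by rewrite normr_gt0.
  pose s := (`|M| + 1 + `|v| + 1) / `|g|.
  have s0 : 0 <= s by rewrite divr_ge0 ?normr_ge0 // !addr_ge0.
  have := MP _ (ray _ s0); rewrite leNgt => /negP[].
  have : `|s *: g| <= `|v - s *: g| + `|v|.
    by rewrite addrC; apply: le_trans (ler_normB _ _); rewrite opprB addrCA subrr addr0.
  rewrite normrZ (ger0_norm s0) /s divfK ?gt_eqF //; lra.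
(* Non-degeneracy enters here: [f] lists all tight rows, and on these [A *m g] is 0 or 1, so a
   blocking row has positive slack. *)
have slack k : (A *m g) k 0 < 0 -> 0 < b k 0 - (A *m v) k 0.
  move=> Agk; rewrite subr_gt0 lt_neqAle Pv andbT; apply/negP => tk.
  have : k \in tight A b v by rewrite in_tight.
  rewrite tightE => /imsetP[j _ kj]; move: Agk; rewrite kj col_basisE.
  by rewrite ltNge ler0n.
pose ratio k := (b k 0 - (A *m v) k 0) / - (A *m g) k 0.
case: (@arg_minP _ _ _ k0 (fun k => (A *m g) k 0 < 0) ratio k0P) => k kP kmin.
have s0 : 0 < ratio k by rewrite divr_gt0 ?slack // oppr_gt0.
set w := v - ratio k *: g.
have kE : (A *m w) k 0 = b k 0.
  rewrite Ag /ratio; field; by rewrite lt_eqF.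
exists (ratio k) => //; rewrite -/w.
have Pw : polyhedron A b w.
  move=> l; rewrite Ag; have [Agl|Agl] := ltP ((A *m g) l 0) 0; last first.
    by apply: le_trans (Pv l); rewrite gerBl mulr_ge0 // ltW.
  have := kmin _ Agl; rewrite {2}/ratio ler_pdivlMr ?oppr_gt0 //; lra.
have fE j : j != i -> (A *m w) (f j) 0 = b (f j) 0.
  move=> ji; rewrite Ag col_basisE (negPf ji) mulr0 subr0 -mul_rowsub Mv.
  by rewrite mxE.
have vE j : (A *m v) (f j) 0 = b (f j) 0 by rewrite -mul_rowsub Mv mxE.
have frM : row_free (rowsub f A) by rewrite row_free_unit.
split.
- by split=> //; exists f; split=> // _ -> j; rewrite in_tight vE.
- split=> //; pose f' j := if j == i then k else f j.
  exists f'; split=> [|_ -> j]; last first.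
    rewrite in_tight /f'; case: (eqVneq j i) => [_|ji].
      by rewrite kE.
    by rewrite fE.
  (* Pairing with [g] kills every row but the new one, so [u 0 i = 0]; what remains is a relation
     among the old independent rows. *)
  apply: inj_row_free => u uf'.
  have ui : u 0 i = 0.
    have : (u *m rowsub f' A *m g) 0 0 = 0 by rewrite uf' mul0mx mxE.
    rewrite -mulmxA mxE (bigD1 i) //= big1 => [|j ji]; last first.
      by rewrite mul_rowsub /f' (negPf ji) col_basisE (negPf ji) mulr0.
    rewrite mul_rowsub /f' eqxx addr0 => /eqP; rewrite mulf_eq0 => /orP[/eqP//|].
    by rewrite lt_eqF.
  have : u *m rowsub f A = 0.
    rewrite -uf'; apply/matrixP => ? l; rewrite !ord1 !mxE; apply: eq_bigr => j _.
    by rewrite !mxE /f'; case: (eqVneq j i) => [->|//]; rewrite ui !mul0r.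
  by move/(congr1 (mulmx^~ G)); rewrite mulmxK // mul0mx.
- move/eqP; rewrite eq_sym -subr_eq0 /w addrAC subrr sub0r oppr_eq0 scaler_eq0.
  by rewrite (gt_eqF s0) (negPf g0).
exists (f \o lift i); split.
  apply/row_freeP; exists (colsub (lift i) G).
  have -> : rowsub (f \o lift i) A *m colsub (lift i) G
      = mxsub (lift i) (lift i) (rowsub f A *m G).
    by apply/matrixP => j l; rewrite !mxE; apply: eq_bigr => ? _; rewrite !mxE.
  rewrite mulmxV //; apply/matrixP => j l; rewrite !mxE.
  by rewrite (inj_eq (@lift_inj _ i)).
move=> u uvw j; rewrite in_tight; have ji : lift i j != i by rewrite eq_sym neq_lift.
by case: uvw => ->; [rewrite vE|rewrite fE].
Qed.

Lemma dot_pivot x s i :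
  (x *m (v - s *: col i G)) 0 0 = (x *m v) 0 0 - s * (x *m G) 0 i.
Proof. by rewrite mulmxBr -scalemxAr [col i G]colE mulmxA -colE !mxE. Qed.

(** For the forward direction, the neighbour across row [i] is feasible, so it cannot improve on
    [v]; its loss is a positive multiple of the [i]-th coordinate. *)
Lemma normal_cone_basisP x : polyhedron A b v -> bounded_set (polyhedron A b) ->
  normal_cone v x <-> forall i, 0 <= (x *m G) 0 i.
Proof.
move=> Pv bndP; split=> [Nx i|]; last exact: normal_cone_basis.
have [s s0 [_ [Pw _] _ _]] := pivot i Pv bndP.
by have := Nx _ Pw; rewrite dot_pivot gerBl pmulr_rge0.
Qed.

End Basis.
End Geometry.

(** * Simplex walks along a segment of objectives *)

Section Walks.
Variables (R : realType) (m n : nat) (A : 'M[R]_(m, n)) (b : 'cV[R]_m).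
Implicit Types (v w y : 'cV[R]_n) (x p q c : 'rV[R]_n).

Local Notation N := (normal_cone A b).
Local Notation N0 := (open_normal_cone A b).

Lemma open_normal_coneW v x : N0 v x -> N v x.
Proof.
move=> vx y Py; have [->//|/eqP yv] := eqVneq y v.
by apply/ltW; exact: vx.
Qed.

Lemma normal_cone_uniq v w x :
  polyhedron A b v -> polyhedron A b w -> N v x -> N0 w x -> v = w.
Proof.
move=> Pv Pw vx wx; apply: contrapT => vw.
by have := wx v Pv vw; rewrite ltNge (vx w Pw).
Qed.

Lemma normal_coneZ v x (a : R) : 0 < a -> N v x -> N v (a *: x).
Proof.
move=> a0 vx y Py; rewrite -!scalemxAl mxE [leRHS]mxE ler_pM2l //; exact: vx.
Qed.

Lemma open_normal_coneZ v x (a : R) : 0 < a -> N0 v x -> N0 v (a *: x).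
Proof.
move=> a0 vx y Py yv; rewrite -!scalemxAl mxE [ltRHS]mxE ltr_pM2l //; exact: vx.
Qed.

Lemma open_normal_coneD v p q : N v p -> N0 v q -> N0 v (p + q).
Proof.
move=> vp vq y Py yv; rewrite !mulmxDl mxE [ltRHS]mxE.
by apply: ler_ltD; [exact: vp|exact: vq].
Qed.

Definition route v w (k : nat) : Prop :=
  exists s : seq 'cV[R]_n,
    [/\ path (fun y y' => `[< Defs.adjacent A b y y' >]) v s,
        last v s = w & (size s <= k)%N].

Lemma route_refl v k : route v v k.
Proof. by exists [::]. Qed.

Lemma route_leq v w k l : (k <= l)%N -> route v w k -> route v w l.
Proof. by move=> kl [s [ps ls ss]]; exists s; split=> //; exact: leq_trans kl. Qed.

Lemma route_step v w u k : Defs.adjacent A b v w -> route w u k -> route v u k.+1.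
Proof.
move=> vw [s [ps ls ss]]; exists (w :: s); split=> //=.
by rewrite ps andbT; apply/asboolP.
Qed.

Lemma route_trans v w u k l : route v w k -> route w u l -> route v u (k + l).
Proof.
move=> [s [ps ls ss]] [t [pt lt st]]; exists (s ++ t); split.
- by rewrite cat_path ps ls.
- by rewrite last_cat ls.
- by rewrite size_cat leq_add.
Qed.

(** Here [s] is the parameter at which the segment leaves the cone of [v]. A coordinate [i] vanishes
    there, so the neighbour across row [i] is optimal too; as that coordinate is decreasing, the
    neighbour is better for [q - p]. *)
Lemma segment_pivot v p q : non_degenerate A b -> bounded_set (polyhedron A b) ->
  vertex A b v -> N v p -> ~ N v q ->
  exists s w, [/\ 0 <= s <= 1, Defs.adjacent A b v w, N w (p + s *: (q - p))
    & ((q - p) *m v) 0 0 < ((q - p) *m w) 0 0].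
Proof.
move=> nd bndP Vv vp vq; have [f vf] := vertexP nd Vv; have Pv := Vv.1.
set G := invmx (rowsub f A).
have p0 : forall i, 0 <= (p *m G) 0 i by apply/(normal_cone_basisP vf).
have eE i : ((q - p) *m G) 0 i = (q *m G) 0 i - (p *m G) 0 i.
  by rewrite mulmxBl !mxE.
have [i0 q0] : exists i, (q *m G) 0 i < 0.
  apply: contrapT => nq; apply: vq; apply: (normal_cone_basis vf) => i.
  by rewrite leNgt; apply/negP => qi; apply: nq; exists i.
have e0 : ((q - p) *m G) 0 i0 < 0 by rewrite eE; have := p0 i0; lra.
pose ratio i := (p *m G) 0 i / - ((q - p) *m G) 0 i.
case: (@arg_minP _ _ _ i0 (fun i => ((q - p) *m G) 0 i < 0) ratio e0) => i ei imin.
set s := ratio i.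
have s0 : 0 <= s by rewrite divr_ge0 // oppr_ge0 ltW.
have s1 : s <= 1.
  apply: le_trans (imin _ e0) _; rewrite ler_pdivrMr ?oppr_gt0 // mul1r eE.
  lra.
have xE j : ((p + s *: (q - p)) *m G) 0 j = (p *m G) 0 j + s * ((q - p) *m G) 0 j.
  by rewrite mulmxDl -scalemxAl !mxE.
have xi : ((p + s *: (q - p)) *m G) 0 i = 0.
  by rewrite xE /s /ratio; field; rewrite lt_eqF.
have vx : N v (p + s *: (q - p)).
  apply: (normal_cone_basis vf) => j; rewrite -/G xE.
  have [ej|ej] := ltP (((q - p) *m G) 0 j) 0; last first.
    by apply: addr_ge0; rewrite // mulr_ge0.
  have := imin _ ej; rewrite {2}/ratio ler_pdivlMr ?oppr_gt0 // -/s; lra.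
have [r r0 vw] := pivot vf i Pv bndP.
exists s, (v - r *: col i G); split=> //; [by rewrite s0| |].
  move=> y Py; rewrite dot_pivot -/G xi mulr0 subr0; exact: vx.
by rewrite dot_pivot -/G ltrDl -mulrN mulr_gt0 // oppr_gt0.
Qed.

(** Vertices are recorded by their tight sets, which live in a finite type; [vertex_tight_inj] makes
    this faithful. *)
Definition touched (S : set 'rV[R]_n) : {set {set 'I_m}} :=
  [set I | `[< exists v, [/\ vertex A b v, tight A b v = I
                           & exists2 x, S x & N v x] >]]%SET.

(** Each pivot strictly increases the functional [q - p], so no vertex recurs, and every vertex
    visited has a cone meeting [S]. *)
Lemma segment_walk (S : set 'rV[R]_n) v p q :
  non_degenerate A b -> bounded_set (polyhedron A b) ->
  (forall x s, S x -> 0 <= s <= 1 -> S (x + s *: (q - x))) ->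
  vertex A b v -> S p -> N v p ->
  exists w, [/\ vertex A b w, N w q & route v w #|touched S|].
Proof.
move=> nd bndP Sq Vv Sp vp.
(* The termination measure: touched vertices still strictly better than [y]. In [walk], the fraction
   [r] of the segment remains to be covered. *)
pose above y : {set {set 'I_m}} := [set I in touched S | `[< exists w,
  [/\ vertex A b w, tight A b w = I & ((q - p) *m y) 0 0 < ((q - p) *m w) 0 0] >]]%SET.
suff walk k y x (r : R) : (#|above y| < k)%N ->
    0 <= r -> q - x = r *: (q - p) -> S x -> vertex A b y -> N y x ->
    exists w, [/\ vertex A b w, N w q & route y w #|above y|].
  have [] := walk #|above v|.+1 v p 1 (ltnSn _) ler01 _ Sp Vv vp.
    by rewrite scale1r.
  move=> w [Vw wq vw]; exists w; split=> //; apply: route_leq vw.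
  by apply/subset_leq_card/fintype.subsetP => I; rewrite inE => /andP[].
elim: k y x r => // k IH y x r card_y r0 qx Sx Vy yx.
have [yq|yq] := pselect (N y q); first by exists y; split=> //; exact: route_refl.
have [s [w [s01 yw wx lt_yw]]] := segment_pivot nd bndP Vy yx yq.
have [_ Vw _ _] := yw; have Sx' := Sq x s Sx s01.
have {}lt_yw : ((q - p) *m y) 0 0 < ((q - p) *m w) 0 0.
  move: lt_yw; rewrite qx -!scalemxAl mxE [ltRHS]mxE.
  move: r0; rewrite le_eqVlt => /orP[/eqP <-|r0]; first by rewrite !mul0r ltxx.
  by rewrite ltr_pM2l.
have above_lt : (#|above w| < #|above y|)%N.
  apply: proper_card; apply/properP; split.
    apply/fintype.subsetP => I; rewrite !inE => /andP[-> /asboolP[u [Vu uI lt_wu]]] /=.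
    by apply/asboolP; exists u; split=> //; apply: lt_trans lt_wu.
  exists (tight A b w); rewrite inE.
    rewrite inE; apply/andP; split; apply/asboolP; last by exists w.
    by exists w; split=> //; eexists; [exact: Sx'|exact: wx].
  rewrite negb_and; apply/orP; right.
  apply/asboolPn => -[u [Vu uw]].
  by rewrite (vertex_tight_inj nd Vu Vw uw) ltxx.
have [|||w' [Vw' w'q ww']] := IH w (x + s *: (q - x)) ((1 - s) * r) _ _ _ Sx' Vw wx.
- by rewrite ltnS in card_y; exact: leq_trans above_lt card_y.
- by rewrite mulr_ge0 // subr_ge0; case/andP: s01.
- by rewrite -scalerA -qx scalerBl scale1r opprD addrA.
by exists w'; split=> //; apply: route_leq (route_step yw ww').
Qed.

End Walks.

(** * Averaging over a lattice of objectives *)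

Section LatticeWalks.
Variables (R : realType) (m n : nat) (A : 'M[R]_(m, n)) (b : 'cV[R]_m).
Variables Z L : nat.
Hypothesis nd : non_degenerate A b.
Hypothesis bndP : bounded_set (polyhedron A b).

Definition deep_in_normal_cone (v : 'cV[R]_n) (z : 'I_n -> int) : Prop :=
  (forall j, (absz (z j) <= Z)%N) /\
  forall u : 'rV[R]_n, (forall j, `|u 0 j| <= 1) ->
    open_normal_cone A b v (\row_j (z j)%:~R + u).

Hypothesis deep : forall v, vertex A b v -> exists z, deep_in_normal_cone v z.

Let W := (L + 2 * Z)%N.
Local Notation box := {ffun 'I_n -> 'I_W}.
Implicit Types (Y : box) (c : 'rV[R]_n) (v w : 'cV[R]_n).

Definition point Y : 'rV[R]_n := \row_j (Y j)%:R.

(** The margin [Z] on both sides keeps translates by vectors of sup-norm at most [Z] inside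
    [box]. *)
Definition inner_box : {set box} := [set Y : box | [forall j, Z <= Y j < Z + L]%N]%SET.

Definition cell c (l : R) Y : set 'rV[R]_n :=
  [set x | forall j, `|(x - (c + l *: point Y)) 0 j| <= l].

Lemma card_inner_box : #|inner_box| = (L ^ n)%N.
Proof.
have -> : #|inner_box|
    = #|@ffun_on_mem 'I_n 'I_W (mem [pred i : 'I_W | Z <= i < Z + L]%N)|.
  by apply: eq_card => Y; rewrite inE; apply: eq_forallb => j; rewrite inE.
rewrite card_ffun_on card_ord; congr (_ ^ _)%N.
have le_W : (Z + L <= W)%N by rewrite /W; lia.
rewrite -[RHS](addKn Z) -[RHS]muln1 -sum_nat_const_nat.
rewrite (big_nat_widen _ _ _ _ _ le_W) (big_nat_widenl _ _ _ _ _ (leq0n Z)).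
by rewrite big_mkord -sum1_card; apply: eq_bigl => i; rewrite inE andbC.
Qed.

(** Pairs of a lattice point and a cone touching its cell inject into [box] by translation by the
    vector [z] of the cone: the image determines the vertex by disjointness, hence [z], hence the
    lattice point. *)
Lemma sum_card_touched c (l : R) : 0 < l ->
  (\sum_(Y in inner_box) #|touched A b (cell c l Y)| <= W ^ n)%N.
Proof.
move=> l0.
(* The choice of [z] depends on the tight set alone, with 0 for sets that belong to no vertex. *)
have zP (I : {set 'I_m}) : {z : 'I_n -> int | forall v, vertex A b v ->
    tight A b v = I -> deep_in_normal_cone v z}.
  apply: cid; have [[v Vv vI]|nv] := pselect (exists2 v, vertex A b v & tight A b v = I).
    have [z vz] := deep Vv; exists z => w Vw wI.
    by rewrite -(vertex_tight_inj nd Vv Vw) // vI.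
  by exists (fun=> 0) => v Vv vI; case: nv; exists v.
(* By [shiftE], neither [absz] nor the default of [insubd] interferes on the pairs in [D]. *)
pose shift (YI : box * {set 'I_m}) : box :=
  [ffun j => insubd (YI.1 j) (absz ((YI.1 j)%:Z + sval (zP YI.2) j))].
pose D : {set box * {set 'I_m}} :=
  [set YI | (YI.1 \in inner_box) && (YI.2 \in touched A b (cell c l YI.1))]%SET.
have shiftE YI j v : YI.1 \in inner_box -> vertex A b v -> tight A b v = YI.2 ->
    (shift YI j)%:Z = (YI.1 j)%:Z + sval (zP YI.2) j.
  rewrite inE => /forallP /(_ j) Yj Vv vI; rewrite ffunE val_insubd.
  have [/(_ j) zj _] := svalP (zP YI.2) v Vv vI.
  move: Yj zj; rewrite /W; set z := sval _ j; set y := nat_of_ord _ => Yj zj.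
  have -> : (absz (y%:Z + z)%R < L + 2 * Z)%N by lia.
  lia.
have DP YI : YI \in D -> exists v, [/\ vertex A b v, tight A b v = YI.2 &
    open_normal_cone A b v (l^-1 *: c + point (shift YI))].
  rewrite inE => /andP[YG]; rewrite inE => /asboolP[v [Vv vI [x Sx vx]]].
  exists v; split=> //.
  have [_ vz] := svalP (zP YI.2) v Vv vI.
  (* A point of the cone, plus [z], plus an error of sup-norm at most 1. *)
  have -> : l^-1 *: c + point (shift YI) = l^-1 *: x +
      (\row_j (sval (zP YI.2) j)%:~R + l^-1 *: (c + l *: point YI.1 - x)).
    apply/matrixP => ? j; rewrite ord1 !mxE -[_%:R]/(_%:Z%:~R) (shiftE _ _ v) //.
    by rewrite intrD /=; field; rewrite gt_eqF.
  apply: open_normal_coneD; first by apply: normal_coneZ; rewrite ?invr_gt0.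
  apply: vz => j; rewrite mxE normrM gtr0_norm ?invr_gt0 // mulrC ler_pdivrMr // mul1r.
  by have := Sx j; rewrite -normrN; congr (`|_| <= _); rewrite !mxE; ring.
have inj_shift : {in D &, injective shift}.
  move=> YI YI' D1 D2 eq_sh.
  have [v [Vv vI vx]] := DP _ D1; have [w [Vw wI wx]] := DP _ D2.
  have vw : v = w.
    by rewrite -eq_sh in wx; apply: normal_cone_uniq (open_normal_coneW vx) wx; [case: Vv|case: Vw].
  have eI : YI.2 = YI'.2 by rewrite -vI -wI vw.
  rewrite [LHS]surjective_pairing [RHS]surjective_pairing -eI; congr pair.
  apply/ffunP => j; apply/val_inj => /=.
  move: D1 D2; rewrite !inE => /andP[D1 _] /andP[D2 _].
  have := congr1 (fun F : box => (F j)%:Z) eq_sh.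
  rewrite /= (shiftE _ _ v) ?inE // (shiftE _ _ w) ?inE // -eI => /addIr [//].
have le_D : (#|D| <= W ^ n)%N.
  by have := leq_card_in shift (mem D) inj_shift; rewrite card_ffun !card_ord.
apply: leq_trans le_D.
rewrite -sum1_card (eq_bigr (fun Y => \sum_(I in touched A b (cell c l Y)) 1)%N); last first.
  by move=> Y _; rewrite sum1_card.
rewrite pair_big_dep /= (eq_bigl (mem D)) // => YI.
by rewrite [RHS]inE.
Qed.

(* Averaged over the lattice points Y of the inner box, the walk that follows
   the objective c + l Y to c' + l' Y uses at most k W ^ n / L ^ n edges. *)
Definition reach k (a a' : 'rV[R]_n * R) : Prop :=
  exists cost : box -> nat, (\sum_(Y in inner_box) cost Y <= k * W ^ n)%N /\
    forall Y v, Y \in inner_box -> vertex A b v ->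
      normal_cone A b v (a.1 + a.2 *: point Y) ->
      exists w, [/\ vertex A b w, normal_cone A b w (a'.1 + a'.2 *: point Y)
                  & route A b v w (cost Y)].

Lemma reach_trans k l a a' a'' :
  reach k a a' -> reach l a' a'' -> reach (k + l) a a''.
Proof.
move=> [f [sf fP]] [g [sg gP]]; exists (fun Y => f Y + g Y)%N; split.
  by rewrite big_split mulnDl leq_add.
move=> Y v YG Vv va; have [w [Vw wa' vw]] := fP Y v YG Vv va.
have [u [Vu ua'' wu]] := gP Y w YG Vw wa'.
by exists u; split=> //; exact: route_trans vw wu.
Qed.

(** A displacement of sup-norm at most [l] keeps the segment inside the cell of [Y], so
    [segment_walk] and [sum_card_touched] apply. *)
Lemma reach_step c c' (l l' : R) : 0 < l ->
  (forall Y j, `|(c' - c + (l' - l) *: point Y) 0 j| <= l) ->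
  reach 1 (c, l) (c', l').
Proof.
move=> l0 small; exists (fun Y => #|touched A b (cell c l Y)|); split.
  by rewrite mul1n; exact: sum_card_touched.
move=> Y v YG Vv vp.
have Sp : cell c l Y (c + l *: point Y).
  by move=> j; rewrite subrr mxE normr0 ltW.
apply: segment_walk Vv Sp vp => //.
move=> x s Sx /andP[s0 s1] j /=.
rewrite (_ : _ 0 j = (1 - s) * (x - (c + l *: point Y)) 0 j
   + s * (c' - c + (l' - l) *: point Y) 0 j); last by rewrite !mxE; ring.
apply: le_trans (ler_normD _ _) _; rewrite !normrM (ger0_norm s0) ger0_norm ?subr_ge0 //.
rewrite [leRHS](_ : l = (1 - s) * l + s * l); last by ring.
by apply: lerD; apply: ler_wpM2l => //; rewrite ?subr_ge0.
Qed.

Lemma reach_iter (a : nat -> 'rV[R]_n * R) k :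
  (forall i, (i < k)%N -> reach 1 (a i) (a i.+1)) -> reach k (a 0%N) (a k).
Proof.
elim: k => [|k IH] step.
  exists (fun=> 0%N); split; first by rewrite sum_nat_const muln0.
  by move=> Y v _ Vv va; exists v; split=> //; exact: route_refl.
rewrite -addn1; apply: reach_trans; last by rewrite addn1; exact: step.
by apply: IH => i ik; apply: step; rewrite ltnW.
Qed.

(** The total cost is at most [2 K L^n] over [L^n] points, so some [Y] costs at most [2 K]. Its walk
    ends at [w], the only maximiser of the final objective. *)
Lemma reach_route K a a' v w : (0 < L)%N -> (W ^ n <= 2 * L ^ n)%N ->
  reach K a a' -> vertex A b v -> vertex A b w ->
  (forall Y, Y \in inner_box -> normal_cone A b v (a.1 + a.2 *: point Y)) ->
  (forall Y, Y \in inner_box -> open_normal_cone A b w (a'.1 + a'.2 *: point Y)) ->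
  route A b v w (2 * K).
Proof.
move=> L0 WL [f [sf fP]] Vv Vw va wa'.
have [Y YG fY] : exists2 Y, Y \in inner_box & (f Y <= 2 * K)%N.
  apply: contrapT => nY.
  have : (\sum_(Y in inner_box) (2 * K).+1 <= \sum_(Y in inner_box) f Y)%N.
    apply: leq_sum => Y YG; rewrite ltnNge; apply/negP => fY; apply: nY.
    by exists Y.
  rewrite sum_nat_const card_inner_box leqNgt => /negP; apply.
  apply: leq_ltn_trans sf _; apply: leq_ltn_trans (leq_mul (leqnn K) WL) _.
  by rewrite mulnCA mulnA [(L ^ n * _)%N]mulnC ltn_pmul2r // expn_gt0 L0.
have [u [Vu ua' [s [ps ls ss]]]] := fP Y v YG Vv (va Y YG).
have uw : u = w by apply: normal_cone_uniq ua' (wa' Y YG); [case: Vu|case: Vw].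
by exists s; split=> //; [rewrite ls|exact: leq_trans fY].
Qed.

Lemma point_ge0 Y j : 0 <= point Y 0 j. Proof. by rewrite mxE ler0n. Qed.

Lemma point_le Y j : point Y 0 j <= W%:R.
Proof. by rewrite mxE ler_nat ltnW. Qed.

(** Coordinates of lattice points are at most [W], so a relative change [1 / W] of the scale moves
    the objective by at most [r]. *)
Lemma reach_scale c (r : R) : (0 < W)%N -> 0 < r ->
  reach 1 (c, r) (c, r * (1 + W%:R^-1)) /\ reach 1 (c, r * (1 + W%:R^-1)) (c, r).
Proof.
move=> W0 r0; have W0' : (0 : R) < W%:R by rewrite ltr0n.
have WV : (0 : R) < W%:R^-1 by rewrite invr_gt0.
have small Y j : 0 <= r * W%:R^-1 * point Y 0 j <= r.
  apply/andP; split; first by rewrite !mulr_ge0 ?point_ge0 // ltW.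
  rewrite -mulrA ger_pMr // mulrC ler_pdivrMr // mul1r; exact: point_le.
split.
  apply: reach_step => // Y j.
  rewrite subrr add0r mulrDr mulr1 addrAC subrr add0r mxE.
  by case/andP: (small Y j) => ? ?; rewrite ger0_norm.
apply: reach_step => [|Y j]; first by rewrite mulr_gt0 // addr_gt0.
rewrite subrr add0r mulrDr mulr1 opprD addrA subrr sub0r mxE mulNr normrN.
case/andP: (small Y j) => ? ?; rewrite ger0_norm //; apply: le_trans (_ : r <= _) => //.
by rewrite lerDl mulr_ge0 ?ltW.
Qed.

Lemma bernoulli_ineq (x : R) k : 0 <= x -> 1 + k%:R * x <= (1 + x) ^+ k.
Proof.
move=> x0; elim: k => [|k IH]; first by rewrite mul0r addr0 expr0.
rewrite exprSr; apply: le_trans (ler_wpM2r _ IH); last by rewrite addr_ge0.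
have : 0 <= k%:R * x * x by rewrite !mulr_ge0 ?ler0n.
rewrite -natr1; lra.
Qed.

Lemma lattice_route t v w : (0 < L)%N -> (W ^ n <= 2 * L ^ n)%N ->
  (Z <= 2 ^ t)%N -> vertex A b v -> vertex A b w ->
  route A b v w (4 * W * t.+1).
Proof.
move=> L0 WL Zt Vv Vw.
have W0 : (0 < W)%N by rewrite /W; lia.
have W0' : (0 : R) < W%:R by rewrite ltr0n.
have [zv [zvZ vP]] := deep Vv; have [zw [zwZ wP]] := deep Vw.
(* The factor [W] makes the box at scale 1 fit: divided by [W], every [ctr z + point Y] lies in the
   unit cube around [z]. *)
pose ctr (z : 'I_n -> int) : 'rV[R]_n := W%:R *: \row_j (z j)%:~R.
pose r : R := 1 + W%:R^-1; pose T := (W * t)%N.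
have r0 : 0 < r by rewrite /r addr_gt0 ?invr_gt0.
(* By Bernoulli [(1 + 1/W)^W >= 2], so [W t] inflations reach the scale [2^t >= Z]. *)
have rT : Z%:R <= r ^+ T.
  apply: le_trans (_ : 2 ^+ t <= _); first by rewrite -natrX ler_nat.
  have r2 : 2 <= r ^+ W.
    have := @bernoulli_ineq W%:R^-1 W; rewrite divff ?gt_eqF // invr_ge0 ler0n.
    exact.
  by rewrite /T exprM lerXn2r // nnegrE ?ler0n // exprn_ge0 // ltW.
have up z : reach T (ctr z, 1) (ctr z, r ^+ T).
  rewrite -[1](expr0 r); apply: (@reach_iter (fun i => (ctr z, r ^+ i))) => i _.
  by rewrite exprSr; apply: (reach_scale _ W0 _).1; rewrite exprn_gt0.
have down z : reach T (ctr z, r ^+ T) (ctr z, 1).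
  have := @reach_iter (fun i => (ctr z, r ^+ (T - i))) T.
  rewrite subn0 subnn expr0; apply => i iT.
  rewrite -{1}(subnSK iT) exprSr; apply: (reach_scale _ W0 _).2.
  by rewrite exprn_gt0.
(* The centres are at most [2 Z W] apart, and each of the [2 W] equal steps is at most [Z], hence at
   most the scale. *)
have across : reach (2 * W) (ctr zv, r ^+ T) (ctr zw, r ^+ T).
  have := @reach_iter
    (fun i => (ctr zv + (i%:R / (2 * W)%:R) *: (ctr zw - ctr zv), r ^+ T)) (2 * W).
  have W2 : ((2 * W)%:R : R) != 0 by rewrite pnatr_eq0 muln_eq0 -lt0n W0.
  rewrite mul0r scale0r addr0 divff // scale1r [ctr zv + (_ - _)]addrC subrK; apply => i _.
  apply: reach_step => [|Y j]; first by rewrite exprn_gt0.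
  rewrite subrr scale0r addr0 opprD addrACA subrr add0r -scalerBl -mulrBl.
  rewrite -natr1 addrAC subrr add0r mul1r /ctr -scalerBr scalerA natrM invfM.
  rewrite mulrVK ?unitfE ?gt_eqF //; apply: le_trans rT.
  rewrite !mxE normrM ger0_norm ?invr_ge0 // mulrC ler_pdivrMr //.
  rewrite -intrB -intr_norm; have := zvZ j; have := zwZ j => zwj zvj.
  have : `|zw j - zv j| <= Z%:Z * 2 by lia.
  by rewrite -(ler_int R) intrM.
have -> : (4 * W * t.+1 = 2 * (T + (2 * W + T)))%N by rewrite /T; lia.
have start z u Y : deep_in_normal_cone u z ->
    open_normal_cone A b u (ctr z + 1 *: point Y).
  move=> [_ uP]; rewrite scale1r.
  have -> : ctr z + point Y = W%:R *: (\row_j (z j)%:~R + W%:R^-1 *: point Y).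
    by rewrite scalerDr scalerA divff ?gt_eqF // scale1r.
  apply: open_normal_coneZ => //; apply: uP => j.
  rewrite mxE ger0_norm ?mulr_ge0 ?invr_ge0 ?ler0n ?point_ge0 // mulrC.
  by rewrite ler_pdivrMr // mul1r point_le.
apply: (reach_route L0 WL (reach_trans (up zv) (reach_trans across (down zw)))) => //.
- by move=> Y _; apply: open_normal_coneW; exact: start.
- by move=> Y _; exact: start.
Qed.

End LatticeWalks.

(** * Choice of parameters and the diameter bound *)

Section DiameterBound.
Variable R : realType.

(** The sum [y] of the tight rows has all coordinates 1 in their basis. A large multiple of it,
    rounded down to integers, stays deep in the cone because the entries of [G] are at most
    [beta]. *)
Lemma exists_deep m n (A : 'M[R]_(m, n)) (b : 'cV[R]_m) v (d beta : R) :
  unit_rows A -> non_degenerate A b -> vertex A b v ->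
  0 < d -> d <= `|\det (tight_mx A b v)| -> 0 < n%:R * beta ->
  max_subdet n.-1 A / d <= beta ->
  exists z, deep_in_normal_cone A b (Num.truncn (3 * n%:R ^+ 2 * beta + 1)) v z.
Proof.
move=> A1 nd Vv d0 dv nb0 Delta_d.
have [f vf] := vertexP nd Vv; have [injf Mu _ _] := vf.
set G := invmx (rowsub f A).
have G_le i j : `|G i j| <= beta.
  apply: le_trans Delta_d; apply: invmx_rowsub_le => //.
  by rewrite -(det_tight_mx vf).
pose y : 'rV[R]_n := const_mx 1 *m rowsub f A.
have yG i : (y *m G) 0 i = 1 by rewrite -mulmxA mulmxV // mulmx1 mxE.
have y_le j : `|y 0 j| <= n%:R.
  rewrite mxE; apply: le_trans (ler_norm_sum _ _ _) _.
  rewrite -[leRHS]mulr1 -[X in X%:R * _](card_ord n) mulr_natl -sumr_const.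
  by apply: ler_sum => i _; rewrite !mxE mul1r; exact: unit_rows_entry.
(* The margin [k] absorbs two errors of at most [n beta]: the rounding of [k y]
   and the displacement [u]. *)
pose k : R := 3 * (n%:R * beta).
have k0 : 0 < k by rewrite mulr_gt0.
exists (fun j => Num.floor (k * y 0 j)).
have near j : `|(Num.floor (k * y 0 j))%:~R - k * y 0 j| <= 1.
  have /andP[] := floor_itv (k * y 0 j); rewrite intrD ler_norml => *.
  by apply/andP; split; lra.
split=> [j|u u1].
  have x0 : 0 <= 3 * n%:R ^+ 2 * beta + 1.
    by rewrite addr_ge0 // expr2 -!mulrA mulr_ge0 // mulr_ge0 // ltW.
  rewrite truncn_ge_nat // -[leLHS]/((_ : nat)%:Z%:~R) abszE intr_norm.
  rewrite -[X in `|X|](subrK (k * y 0 j)); apply: le_trans (ler_normD _ _) _.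
  rewrite addrC; apply: lerD; last exact: near.
  rewrite normrM gtr0_norm // /k expr2 [leRHS](_ : _ = 3 * (n%:R * beta) * n%:R); last by ring.
  by apply: ler_wpM2l => //; exact: ltW.
apply: (open_normal_cone_basis vf) => i; rewrite -/G.
pose e : 'rV[R]_n := \row_j ((Num.floor (k * y 0 j))%:~R - k * y 0 j) + u.
have -> : \row_j (Num.floor (k * y 0 j))%:~R + u = k *: y + e.
  by apply/matrixP => ? j; rewrite ord1 [LHS]mxE [RHS]mxE [in RHS]mxE !mxE; ring.
have -> : ((k *: y + e) *m G) 0 i = k + (e *m G) 0 i.
  by rewrite mulmxDl -scalemxAl mxE [X in X + _]mxE yG mulr1.
have : `|(e *m G) 0 i| <= 2 * (n%:R * beta).
  rewrite mxE; apply: le_trans (ler_norm_sum _ _ _) _.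
  rewrite mulrCA mulr_natl -[X in _ *+ X](card_ord n) -sumr_const.
  apply: ler_sum => j _; rewrite normrM; apply: ler_pM => //.
  rewrite mxE; apply: le_trans (ler_normD _ _) _.
  by rewrite -[2]/(1 + 1); apply: lerD; [rewrite mxE|].
rewrite ler_norml => /andP[+ _]; rewrite /k; move: nb0; lra.
Qed.

(** [key] is Bernoulli's inequality for [(1 - 1/(a+1))^k], cleared of denominators; it is used with
    [a = 2n] and [k = n]. *)
Lemma succ_double_exp_le n : ((2 * n).+1 ^ n <= 2 * (2 * n) ^ n)%N.
Proof.
have key a k : (k <= a.+1)%N -> (a.+1 ^ k * (a.+1 - k) <= a ^ k * a.+1)%N.
  elim: k => [|k IH] ka; first by rewrite !expn0 !mul1n subn0.
  have {}IH := IH (ltnW ka).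
  have : (a.+1 * (a.+1 - k.+1) <= a * (a.+1 - k))%N by nia.
  rewrite !expnSr => H.
  apply: (@leq_trans (a.+1 ^ k * (a * (a.+1 - k)))%N).
    by rewrite -mulnA leq_mul2l H orbT.
  by rewrite [(a * (_ - _))%N]mulnC mulnA [leqRHS]mulnAC leq_mul2r IH orbT.
have := key (2 * n)%N n; rewrite (_ : (2 * n).+1 - n = n.+1)%N; last by lia.
move=> H; rewrite -(leq_pmul2r (ltn0Sn n)); apply: leq_trans (H _) _; first by lia.
by rewrite [leqRHS]mulnAC mulnC leq_mul2r; apply/orP; right; lia.
Qed.

Lemma box_ratio n Z :
  ((4 * n * Z + 2 * Z) ^ n <= 2 * (4 * n * Z) ^ n)%N.
Proof.
have -> : (4 * n * Z + 2 * Z = 2 * Z * (2 * n).+1)%N by lia.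
have -> : (4 * n * Z = 2 * Z * (2 * n))%N by lia.
by rewrite !(expnMn (2 * Z)) mulnCA leq_mul2l succ_double_exp_le orbT.
Qed.

Lemma ln2_ge : 1 / 2 <= ln (2 : R).
Proof.
rewrite -ler_expR lnK ?posrE //.
have := expR_ge1Dx (- (1 / 2) : R); rewrite expRN => H.
rewrite -[leLHS]invrK -[leRHS]invrK lef_pV2 ?posrE ?invr_gt0 ?expR_gt0 //.
apply: le_trans H; lra.
Qed.

Lemma up_log2_le_ln Z : (1 < Z)%N -> (up_log 2 Z)%:R <= 1 + 2 * ln (Z%:R : R).
Proof.
move=> Z1; have t0 : (0 < up_log 2 Z)%N by rewrite up_log_gt0.
have := up_log_gtn (isT : 1 < 2)%N Z1; rewrite -(prednK t0) /=.
set t := (up_log 2 Z).-1 => tZ.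
have : ln (2 ^+ t : R) <= ln (Z%:R : R).
  have Z0 : (0 < Z)%N by apply: ltnW.
  rewrite -natrX ler_ln ?posrE ?ltr0n ?expn_gt0 ?Z0 // ler_nat; exact: ltnW.
rewrite lnXn // -[ln 2 *+ t]mulr_natl => H.
have : t%:R * (1 / 2) <= t%:R * ln (2 : R) by rewrite ler_wpM2l ?ln2_ge.
rewrite -[t.+1%:R]natr1; lra.
Qed.

Lemma least_nat_exists (P : nat -> Prop) k :
  P k -> exists2 d, least P d & (d <= k)%N.
Proof.
move=> Pk; have exP : exists i, `[< P i >] by exists k; apply/asboolP.
case: (ex_minnP exP) => d /asboolP Pd dmin; exists d.
  by split=> // i Pi; rewrite leEnat; apply: dmin; apply/asboolP.
by apply: dmin; apply/asboolP.
Qed.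

(** The constant is [160 = 20 * 4 * 2]: the route has length at most [20 n Z (t + 1)], with
    [Z <= 4 n^2 beta] and [t + 1 <= 2 (1 + ln Z)]. *)
Lemma diameter_bound m n (A : 'M[R]_(m, n)) (b : 'cV[R]_m) (d : R) :
  (2 <= n)%N -> unit_rows A -> bounded_set (polyhedron A b) ->
  non_degenerate A b -> is_min_vertex_det A b d ->
  exists diam, [/\ is_diameter A b diam, 0 < d &
    diam%:R <= 160 * n%:R ^+ 3 * (max_subdet n.-1 A / d)
               * (1 + ln (4 * n%:R ^+ 2 / d))].
Proof.
move=> n2 A1 bndP nd [[v0 Vv0 v0d] dmin].
set Delta := max_subdet n.-1 A.
have [f0 v0f] := vertexP nd Vv0; have [injf0 M0u _ _] := v0f.
have d0 : 0 < d.
  by rewrite -v0d (det_tight_mx v0f) normr_gt0 -unitfE -unitmxE.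
have nR : (2 : R) <= n%:R by rewrite ler_nat.
have nDelta : d <= n%:R * Delta.
  by rewrite -v0d (det_tight_mx v0f); apply: det_rowsub_le => //; exact: ltnW.
pose beta := Delta / d.
have nb1 : 1 <= n%:R * beta by rewrite mulrA ler_pdivlMr // mul1r.
have Delta1 : Delta <= 1 by exact: max_subdet_le1.
pose Z := Num.truncn (3 * n%:R ^+ 2 * beta + 1).
have x2 : n%:R ^+ 2 * beta = n%:R * (n%:R * beta) by ring.
have n2b : 2 <= n%:R ^+ 2 * beta.
  by rewrite x2 -[leLHS]mulr1; apply: ler_pM.
have Zx : Z%:R <= 3 * n%:R ^+ 2 * beta + 1.
  by have := @truncn_itv R (3 * n%:R ^+ 2 * beta + 1); case/(_ _)/andP; first lra.
have Z_le : Z%:R <= 4 * (n%:R ^+ 2 * beta) by lra.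
have Z1 : (1 < Z)%N by rewrite truncn_ge_nat; lra.
pose t := up_log 2 Z.
pose L := (4 * n * Z)%N.
have join : joined_within A b (4 * (L + 2 * Z) * t.+1).
  move=> v w Vv Vw; apply: (@lattice_route _ _ _ _ _ Z L) => //.
  - move=> u Vu; apply: (@exists_deep _ _ _ _ _ d) => //.
    + by apply: dmin; exists u.
    + exact: lt_le_trans nb1.
  - by rewrite !muln_gt0 /= (ltnW n2) ltnW.
  - exact: box_ratio.
  - exact: up_logP.
have [diam diamP diam_le] := least_nat_exists join.
exists diam; split=> //.
(* [Delta1] removes [Delta] from the bound [Z_le]. *)
have lnZ : ln (Z%:R : R) <= ln (4 * n%:R ^+ 2 / d).
  rewrite ler_ln ?posrE.
  - apply: le_trans Z_le _; rewrite -mulrA ler_wpM2l // ler_wpM2l ?sqr_ge0 //.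
    by rewrite /beta ler_piMl // invr_ge0 ltW.
  - by rewrite ltr0n ltnW.
  - by rewrite divr_gt0 // mulr_gt0 // exprn_gt0 //; lra.
have tZ := up_log2_le_ln Z1; rewrite -/t in tZ.
have W_le : (4 * (L + 2 * Z) * t.+1 <= 20 * n * Z * t.+1)%N.
  by rewrite leq_mul2r /L; apply/orP; right; nia.
apply: le_trans (_ : (20 * n * Z * t.+1)%:R <= _).
  by rewrite ler_nat; exact: leq_trans W_le.
rewrite !natrM -/beta.
have -> : 160 * n%:R ^+ 3 * beta * (1 + ln (4 * n%:R ^+ 2 / d))
   = 20 * n%:R * (4 * (n%:R ^+ 2 * beta)) * (2 * (1 + ln (4 * n%:R ^+ 2 / d))) by ring.
apply: ler_pM; rewrite ?mulr_ge0 ?ler0n //.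
  by apply: ler_wpM2l => //; rewrite mulr_ge0 ?ler0n.
rewrite -[t.+1%:R]natr1; lra.
Qed.

End DiameterBound.

(** * The absolute constant and the two cases *)

Theorem theorem2p1 (R : realType) :
  exists C : R, 0 < C /\
    forall (m n : nat) (A : 'M[R]_(m, n)) (b : 'cV[R]_m),
      (2 <= n)%N -> (n < m)%N ->
      unit_rows A ->
      polyhedron A b !=set0 ->
      bounded_set (polyhedron A b) ->
      non_degenerate A b ->
      forall detAstar : R, is_min_vertex_det A b detAstar ->
      exists diam : nat, is_diameter A b diam /\
        (1 / 2 <= detAstar ->
           diam%:R <= C * n%:R ^+ 3 * ln n%:R * max_subdet n.-1 A) /\
        (detAstar < 1 / 2 ->
           diam%:R <= C * (n%:R ^+ 3 * max_subdet n.-1 A / detAstar)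
                        * ln (n%:R / detAstar)).
Proof.
(* [2240 = 160 * 2 * 7], dictated by the first case: [1 / d <= 2], and [1 + 5 ln n <= 7 ln n]
   because [ln n >= 1/2]. *)
exists 2240; split; first by rewrite ltr0n.
move=> m n A b n2 _ A1 _ bndP nd d dmin.
have [diam [diamP d0 diam_le]] := diameter_bound n2 A1 bndP nd dmin.
exists diam; split=> //; move: diam_le; set Delta := max_subdet n.-1 A => diam_le.
have Delta0 : 0 <= Delta by exact: bigmax_ge_id.
have nR : (2 : R) <= n%:R by rewrite ler_nat.
have n0 : (0 : R) < n%:R by apply: lt_le_trans nR.
have n3 : 0 <= n%:R ^+ 3 * Delta by rewrite mulr_ge0 // exprn_ge0 // ltW.
have ln_le x y : 0 < x -> x <= y -> ln x <= ln y :> R.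
  by move=> x0 xy; rewrite ler_ln ?posrE //; apply: lt_le_trans xy.
have ln2 := ln2_ge R.
have arg0 : 0 < 4 * n%:R ^+ 2 / d by rewrite divr_gt0 // mulr_gt0 // exprn_gt0.
split=> d2.
- have lnn : 1 / 2 <= ln (n%:R : R) by apply: le_trans ln2 _; exact: ln_le.
  (* [4 n^2 / d <= 8 n^2 <= n^5]. *)
  have ln_arg : ln (4 * n%:R ^+ 2 / d) <= ln (n%:R : R) * 5.
    rewrite mulr_natr -lnXn //; apply: ln_le => //.
    rewrite ler_pdivrMr //; apply: le_trans (_ : n%:R ^+ 5 * (1 / 2) <= _).
      rewrite (_ : n%:R ^+ 5 * (1 / 2) = n%:R ^+ 3 * (1 / 2) * n%:R ^+ 2); last by ring.
      rewrite ler_wpM2r ?sqr_ge0 //.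
      have : (2 : R) ^+ 3 <= n%:R ^+ 3 by rewrite lerXn2r // nnegrE ?ler0n // ltW.
      lra.
    by rewrite ler_wpM2l // exprn_ge0 // ltW.
  apply: le_trans diam_le _.
  rewrite (_ : 2240 * n%:R ^+ 3 * ln n%:R * Delta
    = (160 * (n%:R ^+ 3 * Delta) * 2) * (7 * ln n%:R)); last by ring.
  rewrite (_ : 160 * n%:R ^+ 3 * (Delta / d) = 160 * (n%:R ^+ 3 * Delta) * d^-1); last by ring.
  apply: (@le_trans _ _ (160 * (n%:R ^+ 3 * Delta) * d^-1 * (7 * ln n%:R))).
    apply: ler_wpM2l; last by lra.
    by rewrite mulr_ge0 ?invr_ge0 ?(ltW d0) // mulr_ge0.
  apply: ler_wpM2r; first lra.
  apply: ler_wpM2l; first by rewrite mulr_ge0.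
  by rewrite -[leRHS]invrK lef_pV2 ?posrE ?invr_gt0 //; lra.
- have nd4 : 4 <= n%:R / d by rewrite ler_pdivlMr //; lra.
  have lnnd : 1 <= ln (n%:R / d).
    apply: le_trans (_ : ln (2 ^+ 2) <= _); first by rewrite lnXn // mulr2n; lra.
    apply: ln_le; first by rewrite exprn_gt0.
    by apply: le_trans nd4; lra.
  (* The cube of [n / d] dominates since [n / d^2 >= 4]; then [1 + 3 ln (n / d)] is well below
     [14 ln (n / d)]. *)
  have ln_arg : ln (4 * n%:R ^+ 2 / d) <= ln (n%:R / d) * 3.
    rewrite mulr_natr -lnXn ?divr_gt0 //; apply: ln_le => //.
    rewrite (_ : (n%:R / d) ^+ 3 = (n%:R / d) * n%:R * (n%:R / d / d)); last by ring.
    rewrite (_ : 4 * n%:R ^+ 2 / d = (n%:R / d) * n%:R * 4); last by ring.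
    apply: ler_wpM2l; first by rewrite !mulr_ge0 ?invr_ge0 ?(ltW n0) ?(ltW d0).
    by rewrite ler_pdivlMr //; lra.
  apply: le_trans diam_le _.
  rewrite [X in _ <= 2240 * X * _](_ : _ = n%:R ^+ 3 * (Delta / d)); last by ring.
  rewrite (_ : 2240 * (n%:R ^+ 3 * (Delta / d)) * ln (n%:R / d)
    = 160 * n%:R ^+ 3 * (Delta / d) * (14 * ln (n%:R / d))); last by ring.
  apply: ler_wpM2l; last by lra.
  by rewrite !mulr_ge0 ?invr_ge0 ?exprn_ge0 ?(ltW n0) ?(ltW d0).
Qed.
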